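(* Let $G$ be an $n$-vertex connected graph. If $n$ is even and $G$ has no perfect matching, or if $n$ is odd and $G$ has no almost perfect matching, then $G$ is not $e$-positive. In particular, if $T$ is an $n$-vertex tree such that either $n$ is even and $T$ has no perfect matching, or $n$ is odd and $T$ has no almost perfect matching, then $T$ is not $e$-positive.
   Context: All graphs are finite and simple. An $n$-vertex graph has exactly $n$ vertices. A perfect matching of $G$ is a subset $M$ of the edges such that every vertex of $G$ is incident to exactly one edge in $M$. A graph $G$ has an almost perfect matching if there is a vertex $v$ of $G$ whose deletion, along with its incident edges, yields a graph that has a perfect matching (the graph with no vertices is regarded as having a perfect matching). Chromatic symmetric function and $e$-positivity: a proper colouring of $G$ is a map $\kappa:V_G\to\{1,2,\ldots\}$ with $\kappa(u)\neq\kappa(v)$ whenever $u,v$ are adjacent. If $V_G=\{v_1,\ldots,v_n\}$, the chromatic symmetric function is $X_G=\sum_\kappa x_{\kappa(v_1)}\cdots x_{\kappa(v_n)}\in\mathbb{Q}[[x_1,x_2,\ldots]]$, summed over all proper colourings $\kappa$ of $G$. The elementary symmetric functions are $e_i=\sum_{j_1<\cdots<j_i}x_{j_1}\cdots x_{j_i}$ for $i\ge 1$ and $e_\lambda=e_{\lambda_1}\cdots e_{\lambda_\ell}$ for a partition $\lambda=(\lambda_1,\ldots,\lambda_\ell)$; they form a basis of the algebra of symmetric functions over $\mathbb{Q}$. The graph $G$ is $e$-positive if $X_G$ is a nonnegative linear combination of the $e_\lambda$. *)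

(* Defs.v *)
From mathcomp Require Import all_boot all_order all_algebra.
From mathcomp Require Import finmap multiset.
From mathcomp Require Import boolp classical_sets functions cardinality fsbigop.

Set Implicit Arguments.
Unset Strict Implicit.
Unset Printing Implicit Defensive.

Import Order.TTheory GRing.Theory Num.Theory.

Local Open Scope ring_scope.

(** A finite simple graph on [V] is given by its adjacency relation [e : rel V],
    assumed symmetric and irreflexive. *)

Section Graphs.
Variables (V : finType) (e : rel V).

Definition edges : {set {set V}} :=
  [set [set p.1; p.2]%SET | p : V * V & e p.1 p.2]%SET.

Definition perfect_matching (M : {set {set V}}) : Prop :=
  M \subset edges /\ forall v : V, #|[set f in M | v \in f]%SET| = 1%N.

Definition has_perfect_matching : Prop :=
  exists M : {set {set V}}, perfect_matching M.

Definition graph_connected : Prop := forall x y : V, connect e x y.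

(* [cycle e [:: x; y]] holds on every edge xy, so the cycles of a simple graph
   are the duplicate-free [e]-cycles of length at least 3. *)
Definition graph_acyclic : Prop :=
  forall c : seq V, ucycle e c -> (size c <= 2)%N.

Definition is_tree : Prop := graph_connected /\ graph_acyclic.

Definition del_vertex (v : V) : rel {x : V | x != v} :=
  fun x y => e (val x) (val y).

End Graphs.

Definition has_almost_perfect_matching (V : finType) (e : rel V) : Prop :=
  exists v : V, has_perfect_matching (@del_vertex V e v).

(** Formal power series over the rationals in countably many variables. The
    variables are indexed by [nat], so x_1, x_2, ... become x_0, x_1, ...
    A monomial is the finite multiset of the indices of its variables: the
    product of the x_j for j in s is [seq_mset s], and the product of two
    monomials is the multiset sum. A power series is its family of
    coefficients. *)

Definition monomial := {mset nat}%mset.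

Definition pseries := monomial -> rat.

Definition ps_one : pseries := fun m => (m == mset0)%:R.

(* Finitely supported sums are 0 by convention on infinite supports; this is
   never used here, see [finite_factorizations], [finite_colorings] and
   [finite_increasing] below. *)
Definition ps_mul (f g : pseries) : pseries := fun m =>
  \sum_(p \in [set p : monomial * monomial | p.1 `+` p.2 = m]%mset%classic)
     (f p.1 * g p.2).

(* The sum, over all a in A, of the monomials w a. *)
Definition ps_sum (I : choiceType) (A : set I) (w : I -> monomial) : pseries :=
  fun m => \sum_(a \in [set a | A a /\ w a = m]%classic) (1 : rat).

Definition coloring_monomial (V : finType) (k : {ffun V -> nat}) : monomial :=
  seq_mset [seq k v | v <- enum V].

Definition proper_coloring (V : finType) (e : rel V) (k : {ffun V -> nat}) :
    Prop :=
  forall u v : V, e u v -> k u <> k v.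

Definition chromatic_symmetric (V : finType) (e : rel V) : pseries :=
  ps_sum [set k | proper_coloring e k]%classic (@coloring_monomial V).

Definition elementary (i : nat) : pseries :=
  ps_sum [set j : i.-tuple nat | sorted ltn j]%classic
         (fun j => seq_mset (tval j)).

Definition is_partition (l : seq nat) : bool :=
  sorted geq l && all (fun i => 0 < i)%N l.

Definition elementary_part (l : seq nat) : pseries :=
  \big[ps_mul/ps_one]_(i <- l) elementary i.

Definition e_positive (V : finType) (e : rel V) : Prop :=
  exists (S : {fset seq nat}) (c : seq nat -> rat),
    (forall l, l \in S -> is_partition l /\ 0 <= c l) /\
    chromatic_symmetric e =1
      (fun m => \sum_(l <- S) c l * elementary_part l m).

Lemma finite_seq_mset (m : monomial) :
  finite_set [set s : seq nat | seq_mset s = m]%classic.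
Proof.
apply: (@sub_finite_set _ _ [set` permutations (enum_mset m)]%classic).
  move=> s /= sm; rewrite mem_permutations -sm perm_sym.
  exact: perm_eq_seq_mset.
exact: finite_seq.
Qed.

Lemma finite_factorizations (m : monomial) :
  finite_set [set p : monomial * monomial | p.1 `+` p.2 = m]%mset%classic.
Proof.
pose f (p : nat * seq nat) : monomial * monomial :=
  (seq_mset (take p.1 p.2), seq_mset (drop p.1 p.2)).
apply: (@sub_finite_set _ _
  (f @` (`I_(size (enum_mset m)).+1 `*` [set s | seq_mset s = m]))%classic); last first.
  apply/finite_image/finite_setX; first exact: finite_II.
  exact: finite_seq_mset.
case=> a b /= abm.
have cab : seq_mset (enum_mset a ++ enum_mset b) = m.
  by apply/fsfunP => i; rewrite -abm mset_seqE count_cat !count_mem_mset msetE2.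
exists (size (enum_mset a), enum_mset a ++ enum_mset b); last first.
  by rewrite /f /= take_size_cat // drop_size_cat // !seq_mset_id.
split=> //=; rewrite ltnS.
have /perm_size -> : perm_eq (enum_mset m) (enum_mset a ++ enum_mset b).
  by rewrite -cab perm_eq_seq_mset.
by rewrite size_cat leq_addr.
Qed.

Lemma finite_colorings (V : finType) (e : rel V) (m : monomial) :
  finite_set [set k : {ffun V -> nat} |
    proper_coloring e k /\ coloring_monomial k = m]%classic.
Proof.
pose f (s : seq nat) := [ffun v : V => nth 0%N s (enum_rank v)].
apply: (@sub_finite_set _ _ (f @` [set s | seq_mset s = m])%classic).
  move=> k /= [_ km]; exists [seq k v | v <- enum V] => //.
  apply/ffunP => v; rewrite ffunE (nth_map v) -?cardE ?ltn_ord //.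
  by rewrite nth_enum_rank.
exact/finite_image/finite_seq_mset.
Qed.

Lemma finite_increasing (i : nat) (m : monomial) :
  finite_set [set j : i.-tuple nat | sorted ltn j /\ seq_mset (tval j) = m]%classic.
Proof.
pose f (s : seq nat) : i.-tuple nat := insubd [tuple 0%N | k < i] s.
apply: (@sub_finite_set _ _ (f @` [set s | seq_mset s = m])%classic).
  by move=> j /= [_ jm]; exists (tval j) => //; rewrite /f valKd.
exact/finite_image/finite_seq_mset.
Qed.

(* Main.v *)
Require Import Defs.
From mathcomp Require Import all_boot all_order all_algebra.
From mathcomp Require Import finmap multiset.
From mathcomp Require Import boolp classical_sets functions cardinality fsbigop.
From mathcomp Require Import zify ring lra.

(** Suppose that [G] is connected on [n > 0] vertices and that its chromatic
    symmetric function is a nonnegative combination of the [e_l]. Two linear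
    functionals on symmetric functions of degree [n] give contradictory
    information on the coefficient [c] of [e_n].

    The first is the linear coefficient of the chromatic polynomial. Putting
    [q] variables equal to 1 and the others to 0 sends [e_l] to the product of
    the binomials [q choose l_i], which is divisible by [q ^ 2] as soon as [l]
    has two parts. The chromatic polynomial of a connected graph is not
    divisible by [q ^ 2] (deletion and contraction, [chromatic_polynomial]), so
    [c] is not zero ([connected_linear_coef]).

    The second extracts, up to a nonzero factor, the coefficient of
    [p_2 ^ (n / 2)] in power sums, or of [p_1 * p_2 ^ ((n - 1) / 2)] for odd
    [n]. Concretely, the colours below
    [n] are grouped in blocks [{2i, 2i+1}] (a last block is a singleton when [n]
    is odd), only the colourings that use each block as often as it has colours
    are kept, and a colouring [k] counts with the sign [(-1) ^ (sum of k)]. If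
    some block is used by two nonadjacent vertices, changing the colour of one
    of them within the block is a sign-reversing move. What survives
    ([sum_block_weight]) are the bijective colourings in which the vertices of a
    common block are adjacent, all with the same sign. Such a colouring is
    exactly a perfect matching of [G] (even [n]) or of [G] minus a vertex (odd
    [n]), with a labelling.

    Both functionals are evaluated on [e_l] by the same lemmas as on [G]: up to
    the factor [prod l_i!], [e_l] is the chromatic symmetric function of a
    disjoint union of cliques of sizes [l_i] ([chromatic_cliques]). Hence the
    second functional has the same sign on [G] and on every [e_l], and it is
    nonzero on [e_n]. If it vanishes on [G], nonnegativity of the coefficients
    forces [c = 0]. *)

Set Implicit Arguments.
Unset Strict Implicit.
Unset Printing Implicit Defensive.

Import Order.TTheory GRing.Theory Num.Theory.
Local Open Scope ring_scope.

(** * The linear coefficient of the chromatic polynomial *)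

Lemma connect_homo (T U : finType) (e : rel T) (e' : rel U) (f : T -> U) :
    (forall x y, e x y -> connect e' (f x) (f y)) ->
  forall x y, connect e x y -> connect e' (f x) (f y).
Proof.
move=> ef x y /connectP[p].
elim: p x => [|z p IHp] x /=; first by move=> _ ->.
by case/andP=> /ef xz zp yE; apply: connect_trans xz (IHp _ zp yE).
Qed.

(** Graphs are given here by lists of pairs, loops and repetitions allowed:
    this class is closed under contraction, and the length of the list is the
    induction parameter of deletion-contraction. *)
Section EdgeLists.
Variables (V : finType) (s : seq (V * V)).

Definition list_colorings q : {set {ffun V -> 'I_q}} :=
  [set k : {ffun V -> 'I_q} | all (fun p => k p.1 != k p.2) s]%SET.

Definition list_adj : rel V := fun x y => ((x, y) \in s) || ((y, x) \in s).

Definition loopless := all (fun p => p.1 != p.2) s.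

Definition list_connected := forall x y, connect list_adj x y.

End EdgeLists.

Section Contraction.
Variables (V : finType) (a b : V).
Hypothesis ab : a != b.

Definition contracted : finType := {x : V | x != b}.

Definition contract (x : V) : contracted :=
  insubd (exist (fun x => x != b) a ab) x.

Lemma val_contract x : val (contract x) = if x == b then a else x.
Proof. by rewrite val_insubd /=; case: eqVneq. Qed.

Lemma contractK (y : contracted) : contract (val y) = y.
Proof. by apply: val_inj; rewrite val_contract (negPf (valP y)). Qed.

Definition contract_edges (s : seq (V * V)) :=
  [seq (contract p.1, contract p.2) | p <- s].

Lemma card_contracted : #|V| = #|contracted|.+1.
Proof. by rewrite card_sig cardC1 prednK //; apply/card_gt0P; exists b. Qed.

(** A colouring of the graph without the edge [ab] either separates [a] and [b],
    and then respects [ab], or identifies them, and then factors through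
    [contract]. *)
Lemma card_delete_contract s q :
  #|list_colorings s q| =
    (#|list_colorings ((a, b) :: s) q|
     + #|list_colorings (contract_edges s) q|)%N.
Proof.
rewrite -(cardsID [set k : {ffun V -> 'I_q} | k a != k b]%SET (list_colorings s q)).
congr (_ + _)%N; first by apply: eq_card => k; rewrite !inE /= andbC.
pose lift (k : {ffun contracted -> 'I_q}) := [ffun x => k (contract x)].
rewrite -(card_imset _ (_ : injective lift)); last first.
  move=> k k' /ffunP kk'; apply/ffunP=> y.
  by have := kk' (val y); rewrite !ffunE contractK.
apply: eq_card => k; rewrite !inE negbK.
apply/andP/imsetP => [[/eqP kab ks]|[k' + ->]]; last first.
  rewrite inE all_map !ffunE => k's; split; last first.
    by apply: sub_all k's => p; rewrite /= !ffunE.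
  by apply/eqP; congr (k' _); apply: val_inj; rewrite !val_contract eqxx (negPf ab).
have kc x : k (val (contract x)) = k x.
  by rewrite val_contract; case: eqP => // ->.
exists [ffun y => k (val y)]; last by apply/ffunP=> x; rewrite !ffunE kc.
by rewrite inE all_map; apply: sub_all ks => p; rewrite /= !ffunE !kc.
Qed.

Lemma contract_connected s :
  list_connected ((a, b) :: s) -> list_connected (contract_edges s).
Proof.
move=> con x y; rewrite -(contractK x) -(contractK y).
apply: connect_homo (con (val x) (val y)) => u v.
rewrite /list_adj !inE => uv.
have abE : contract a = contract b.
  by apply: val_inj; rewrite !val_contract eqxx (negPf ab).
case/orP: uv => /orP[/eqP[-> ->]|uv]; rewrite ?abE ?connect0 //; apply: connect1.
  by apply/orP; left; apply: (map_f (fun p => (contract p.1, contract p.2)) uv).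
by apply/orP; right; apply: (map_f (fun p => (contract p.1, contract p.2)) uv).
Qed.

(** Contracting [ab] creates a loop only from a second copy of [ab]. *)
Lemma contract_loopless s :
  ~~ list_adj s a b -> loopless s -> loopless (contract_edges s).
Proof.
move=> nab /allP ls; rewrite /loopless all_map; apply/allP => -[x y] xys /=.
apply/eqP => /(congr1 val); rewrite !val_contract.
have /= := ls _ xys; case: (eqVneq x b) => [xb|_]; case: (eqVneq y b) => [yb|_] //.
- by rewrite xb yb eqxx.
- by move=> _ aE; rewrite /list_adj aE -xb xys orbT in nab.
- by move=> _ aE; rewrite /list_adj -aE -yb xys in nab.
- by move=> /eqP.
Qed.

End Contraction.

(** Deletion minus contraction: contraction lowers the number of vertices by one,
    so the two signed linear coefficients add up. Both are nonnegative, and that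
    of the contraction is positive by induction when the graph is connected and
    [ab] is not repeated. The weak inequality is stated for all lists because
    deletion may disconnect the graph. *)
Lemma chromatic_polynomial (V : finType) (s : seq (V * V)) : (0 < #|V|)%N ->
  exists p : {poly rat},
    [/\ forall q, p.[q%:R] = #|list_colorings s q|%:R,
        0 <= (-1) ^+ #|V|.-1 * p`_1
      & loopless s -> list_connected s -> 0 < (-1) ^+ #|V|.-1 * p`_1].
Proof.
move sz: (size s) => k; elim: k V s sz => [|k IHk] V s sz V_gt0.
  case: s sz => // _; exists 'X^#|V|; split=> [q||_ con].
  - rewrite hornerXn -natrX; congr (_%:R).
    have -> : list_colorings [::] q = [set: {ffun V -> 'I_q}]%SET.
      by apply/setP => k; rewrite !inE.
    by rewrite cardsT card_ffun card_ord.
  - by rewrite coefXn; case: eqP => [<-|]; rewrite ?mulr0 // expr0 mul1r ler01.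
  - have -> : #|V| = 1%N; last by rewrite coefXn expr0 mul1r ltr01.
    have [x _] := card_gt0P V_gt0; rewrite -(card1 x); apply: eq_card => y.
    rewrite !inE; apply/esym/eqP; have /connectP[[|z p] /=] := con x y; first by [].
    by rewrite /list_adj.
case: s sz => // -[a b] s [sz].
case: (eqVneq a b) => [<-|ab].
  exists 0; split=> [q||]; rewrite ?coef0 ?mulr0 ?horner0 //=.
    rewrite (_ : list_colorings _ _ = finset.set0) ?cards0 //.
    by apply/setP=> c; rewrite !inE /= eqxx.
  by rewrite /loopless /= eqxx.
have [p [pE p_ge0 p_gt0]] := IHk _ _ sz V_gt0.
(* A repeated edge changes nothing; contracting it would create a loop. *)
have [par|npar] := boolP (list_adj s a b).
  exists p; split=> // [q|/andP[_ ls] con].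
    rewrite pE; congr (_%:R); apply: eq_card => c; rewrite !inE /=.
    apply/esym/andb_idl => /allP cs; case/orP: par => /cs //=.
    by rewrite eq_sym.
  apply: p_gt0 => // x y; apply: connect_sub (con x y) => u v.
  rewrite /list_adj !inE => uv; apply: connect1.
  case/orP: uv => /orP[/eqP[-> ->]|uv]; rewrite ?[list_adj s _ _]orbC ?par //.
  - by rewrite /list_adj uv.
  - by move: par; rewrite /list_adj orbC.
  - by rewrite /list_adj uv orbT.
have szc : size (contract_edges ab s) = k by rewrite size_map.
have cardV := card_contracted b.
have c_gt0 : (0 < #|contracted b|)%N by apply/card_gt0P; exists (contract ab a).
have [p' [p'E p'_ge0 p'_gt0]] := IHk _ _ szc c_gt0.
have signE : (-1) ^+ #|V|.-1 * (p - p')`_1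
    = (-1) ^+ #|V|.-1 * p`_1 + (-1) ^+ #|contracted b|.-1 * p'`_1.
  by rewrite coefB cardV /= -(prednK c_gt0) exprS /=; ring.
exists (p - p'); split=> [q||/andP[_ ls] con].
- by rewrite hornerD hornerN pE p'E (card_delete_contract ab) natrD addrK.
- by rewrite signE addr_ge0.
- rewrite signE ltr_wpDl // p'_gt0 //; first exact: contract_loopless.
  exact: contract_connected.
Qed.

(** * Colourings with finitely many colours and disjoint unions *)

(** The colours may form any finite type, so that restricting to [N] colours
    gives finite sums; [proper_coloring] has all natural numbers as colours. *)
Definition properb (V C : finType) (e : rel V) (k : {ffun V -> C}) :=
  [forall u, forall v, e u v ==> (k u != k v)].

Lemma properP (V C : finType) (e : rel V) (k : {ffun V -> C}) :
  reflect (forall u v, e u v -> k u != k v) (properb e k).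
Proof.
apply: (iffP forallP) => [H u v|H u]; first by move/forallP: (H u) => /(_ v)/implyP.
by apply/forallP => v; apply/implyP/H.
Qed.

Definition colors (V : finType) N (k : {ffun V -> 'I_N}) : seq nat :=
  [seq val (k v) | v <- enum V].

Definition bounded_colors N (m : monomial) := {in enum_mset m, forall i, (i < N)%N}.

Lemma ps_sum_seq (I : choiceType) (A : set I) (w : I -> monomial) (m : monomial)
    (r : seq I) :
    uniq r -> (forall a, a \in r <-> A a /\ w a = m) ->
  ps_sum A w m = (size r)%:R.
Proof.
move=> r_uniq rE; rewrite /ps_sum.
have -> : [set a | A a /\ w a = m]%classic = [set` r]%classic.
  by apply/seteqP; split=> a /= /rE.
by rewrite -fsbig_seq // big_const_seq count_predT iter_addr_0.
Qed.

(** Only colourings with colours below [N] produce a monomial in the first [N]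
    variables. *)
Lemma chromatic_coef (V : finType) (e : rel V) N (m : monomial) :
    bounded_colors N m ->
  chromatic_symmetric e m =
    \sum_(k : {ffun V -> 'I_N} | properb e k) (seq_mset (colors k) == m)%:R.
Proof.
move=> mN.
pose up (k : {ffun V -> 'I_N}) : {ffun V -> nat} := [ffun v => val (k v)].
have up_inj : injective up.
  move=> k k' /ffunP kk'; apply/ffunP => v; apply: val_inj.
  by have := kk' v; rewrite !ffunE.
have upE k : coloring_monomial (up k) = seq_mset (colors k).
  by congr seq_mset; apply: eq_map => v; rewrite ffunE.
pose A := [pred k : {ffun V -> 'I_N} | properb e k && (seq_mset (colors k) == m)].
rewrite /chromatic_symmetric (@ps_sum_seq _ _ _ _ [seq up k | k in A]).
- by rewrite size_image -sum1_card natr_sum big_mkcondr; apply: eq_bigr => k _; case: eqP.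
- by rewrite map_inj_uniq ?enum_uniq.
move=> k; split=> [/mapP[{}k + ->]|[/= kp km]].
  rewrite mem_enum => /andP[/properP kp /eqP km]; split; last by rewrite upE.
  by move=> u v uv; rewrite !ffunE => /val_inj; apply/eqP/kp.
have kN v : (k v < N)%N.
  apply: mN; rewrite -km (perm_mem (perm_eq_seq_mset _)).
  by apply: map_f; rewrite mem_enum.
have kE : k = up [ffun v => Ordinal (kN v)] by apply/ffunP => v; rewrite !ffunE.
rewrite kE; apply: map_f; rewrite mem_enum inE -upE -kE km eqxx andbT.
apply/properP => u v uv; rewrite !ffunE -val_eqE /=; exact/eqP/kp.
Qed.

Definition sum_adj (U W : finType) (d : rel U) (e : rel W) : rel (U + W)%type :=
  fun x y => match x, y with
             | inl u, inl v => d u v | inr u, inr v => e u v | _, _ => false end.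

Section SumColorings.
Variables (U W C : finType) (d : rel U) (e : rel W).

Definition join_coloring (p : {ffun U -> C} * {ffun W -> C}) : {ffun U + W -> C} :=
  [ffun x => match x with inl u => p.1 u | inr w => p.2 w end].

Lemma join_coloring_bij : bijective join_coloring.
Proof.
exists (fun k : {ffun U + W -> C} =>
          ([ffun u => k (inl u)], [ffun w => k (inr w)])).
  by case=> k1 k2; congr pair; apply/ffunP => x; rewrite !ffunE.
by move=> k; apply/ffunP => -[]x; rewrite !ffunE.
Qed.

Lemma properb_join p :
  properb (sum_adj d e) (join_coloring p) = properb d p.1 && properb e p.2.
Proof.
apply/properP/andP => [H|[/properP H1 /properP H2]]; last first.
  by case=> u [] v //= uv; rewrite !ffunE; [apply: H1 | apply: H2].
split; apply/properP => u v uv.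
  by have := H (inl u) (inl v) uv; rewrite !ffunE.
by have := H (inr u) (inr v) uv; rewrite !ffunE.
Qed.

Lemma big_sum_adj (F : {ffun U + W -> C} -> rat) :
  \sum_(k | properb (sum_adj d e) k) F k =
  \sum_(k1 | properb d k1) \sum_(k2 | properb e k2) F (join_coloring (k1, k2)).
Proof.
rewrite (reindex join_coloring) /=; last exact: onW_bij join_coloring_bij.
rewrite pair_big /=; apply: eq_big => [p|[]//]; exact: properb_join.
Qed.

End SumColorings.

Lemma colors_join (U W : finType) N (k1 : {ffun U -> 'I_N}) (k2 : {ffun W -> 'I_N}) :
  seq_mset (colors (join_coloring (k1, k2))) =
    (seq_mset (colors k1) `+` seq_mset (colors k2))%mset.
Proof.
apply/msetP => i; rewrite msetE2 !mset_seqE -count_cat; congr (count _ _).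
rewrite /colors !enumT [@Finite.enum in LHS]unlock /= /sum_enum map_cat -!map_comp.
by congr cat; apply: eq_map => x; rewrite /= ffunE.
Qed.

Lemma ps_mul_finite (f g : pseries) (m : monomial) :
  ps_mul f g m =
    \sum_(p <- fset_set [set p : monomial * monomial | p.1 `+` p.2 = m]%mset%classic)
      f p.1 * g p.2.
Proof. by rewrite /ps_mul fsbig_finite //; apply: finite_factorizations. Qed.

(** A colouring of a disjoint union is a pair of colourings, and its monomial is
    the product of theirs; sorting the pairs by their two monomials gives the
    product of series. *)
Lemma chromatic_sum_adj (U W : finType) (d : rel U) (e : rel W) :
  chromatic_symmetric (sum_adj d e) =1
    ps_mul (chromatic_symmetric d) (chromatic_symmetric e).
Proof.
move=> m; rewrite ps_mul_finite.
(* All variables of [m], hence of its divisors, have index below [N]. *)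
pose N := (\max_(i <- enum_mset m) i).+1.
have mN : bounded_colors N m by move=> i im; rewrite ltnS leq_bigmax_seq.
set P := fset_set _.
have inP p : (p \in P) = (p.1 `+` p.2 == m)%mset.
  rewrite in_fset_set; last exact: finite_factorizations.
  by apply/idP/eqP => [/set_mem | pm]; [ | apply: mem_set].
rewrite (chromatic_coef _ mN) big_sum_adj.
transitivity (\sum_(p <- P) \sum_(k1 : {ffun U -> 'I_N} | properb d k1)
   \sum_(k2 : {ffun W -> 'I_N} | properb e k2)
     (p == (seq_mset (colors k1), seq_mset (colors k2)))%:R : rat).
  rewrite [RHS]exchange_big; apply: eq_bigr => k1 _.
  rewrite [RHS]exchange_big; apply: eq_bigr => k2 _.
  rewrite colors_join; set p := (_, _).
  rewrite -[X in (X == m)]/(p.1 `+` p.2)%mset -inP.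
  have [pP|pP] := boolP (p \in P).
    rewrite (bigD1_seq p) ?fset_uniq // eqxx big1 ?addr0 // => q /negPf qp.
    by rewrite qp.
  by rewrite big1_seq // => q /= qP; case: eqP => // qp; rewrite -qp qP in pP.
rewrite big_seq [RHS]big_seq; apply: eq_bigr => -[a b]; rewrite inP => /eqP /= abm.
rewrite !(@chromatic_coef _ _ N); first last.
- by move=> i ia; apply: mN; rewrite -abm in_msetD ia.
- by move=> i ib; apply: mN; rewrite -abm in_msetD ib orbT.
rewrite big_distrl; apply: eq_bigr => k1 _; rewrite big_distrr; apply: eq_bigr => k2 _.
by rewrite /= -natrM mulnb xpair_eqE ![_ == seq_mset _]eq_sym.
Qed.

(** * Elementary symmetric functions as chromatic functions of cliques *)

(** A squarefree monomial is the product of exactly one increasing tuple. *)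
Lemma elementary_coef i (m : monomial) :
  elementary i m = (uniq (enum_mset m) && (size (enum_mset m) == i))%:R.
Proof.
have [/andP[m_uniq /eqP m_size]|Nm] := boolP (_ && _); last first.
  rewrite /elementary (@ps_sum_seq _ _ _ _ [::]) // => t; split=> // -[/= t_lt tm].
  have tp : perm_eq (enum_mset m) t by rewrite -tm perm_eq_seq_mset.
  case/negP: Nm; rewrite (perm_uniq tp) (perm_size tp) size_tuple eqxx andbT.
  by move: t_lt; rewrite ltn_sorted_uniq_leq => /andP[].
pose s := sort leq (enum_mset m).
have sp : perm_eq s (enum_mset m) by rewrite perm_sort.
have s_lt : sorted ltn s.
  by rewrite ltn_sorted_uniq_leq (perm_uniq sp) m_uniq sort_sorted //; apply: leq_total.
have s_size : size s == i by rewrite size_sort m_size.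
rewrite /elementary (@ps_sum_seq _ _ _ _ [:: Tuple s_size]) // => t.
rewrite inE; split=> [/eqP -> /=|[/= t_lt tm]].
  by split=> //; rewrite -[RHS](seq_mset_id m); apply/eq_seq_msetP.
apply/eqP/val_inj/(irr_sorted_eq ltn_trans ltnn t_lt s_lt).
apply: perm_mem; rewrite perm_sym; apply: perm_trans sp _.
by rewrite -tm perm_eq_seq_mset.
Qed.

Definition complete_adj (V : finType) : rel V := fun x y => x != y.

(** The proper colourings of a clique with a given squarefree monomial are the
    orderings of its variables. *)
Lemma chromatic_complete i (m : monomial) :
  chromatic_symmetric (@complete_adj 'I_i) m = i`!%:R * elementary i m.
Proof.
rewrite elementary_coef.
pose h (s : seq nat) := [ffun v : 'I_i => nth 0%N s v].
have map_h s : size s = i -> [seq h s v | v <- enum 'I_i] = s.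
  move=> si; rewrite -[RHS](mkseq_nth 0%N) si /mkseq -val_enum_ord -map_comp.
  by apply: eq_map => v; rewrite /= ffunE.
have hE (k : {ffun 'I_i -> nat}) : h [seq k v | v <- enum 'I_i] = k.
  by apply/ffunP => v; rewrite ffunE (nth_map v) ?size_enum_ord // nth_ord_enum.
have props (k : {ffun 'I_i -> nat}) :
    proper_coloring (@complete_adj 'I_i) k -> uniq [seq k v | v <- enum 'I_i].
  move=> kp; rewrite map_inj_uniq ?enum_uniq // => u v kuv.
  by apply/eqP; apply: contraT => /kp.
have [/andP[m_uniq /eqP m_size]|Nm] := boolP (_ && _); last first.
  rewrite mulr0 /chromatic_symmetric (@ps_sum_seq _ _ _ _ [::]) // => k.
  split=> // -[/= /props k_uniq km].
  have kp : perm_eq (enum_mset m) [seq k v | v <- enum 'I_i].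
    by rewrite -km perm_eq_seq_mset.
  case/negP: Nm; rewrite (perm_uniq kp) (perm_size kp) k_uniq size_map size_enum_ord.
  exact: eqxx.
rewrite mulr1 -[in RHS]m_size -(size_permutations m_uniq) -(size_map h).
have perm_sizeE s : s \in permutations (enum_mset m) -> size s = i.
  by rewrite mem_permutations => /perm_size ->.
apply: ps_sum_seq.
  rewrite map_inj_in_uniq ?permutations_uniq // => s t /perm_sizeE si /perm_sizeE ti st.
  by rewrite -(map_h _ si) st map_h.
move=> k; split=> [/mapP[s sm ->]|[/= kp km]].
  have si := perm_sizeE _ sm; move: sm; rewrite mem_permutations => sm; split.
    move=> u v /= uv; rewrite !ffunE; apply/eqP; rewrite nth_uniq ?si //.
    by rewrite (perm_uniq sm).
  by rewrite /coloring_monomial map_h // -[RHS]seq_mset_id; apply/eq_seq_msetP.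
rewrite -(hE k); apply: map_f.
by rewrite mem_permutations -km perm_sym perm_eq_seq_mset.
Qed.

Fixpoint clique_vertices (l : seq nat) : finType :=
  if l is i :: l' then ('I_i + clique_vertices l')%type else void.

Fixpoint clique_adj (l : seq nat) : rel (clique_vertices l) :=
  if l is i :: l' then sum_adj (@complete_adj 'I_i) (@clique_adj l')
  else fun _ _ => false.

Lemma card_clique_vertices l : #|clique_vertices l| = sumn l.
Proof. by elim: l => [|i l IHl] /=; rewrite ?card_void // card_sum card_ord IHl. Qed.

Definition prod_fact (l : seq nat) := (\prod_(i <- l) i`!)%N.

(** This turns every identity between the series of a graph and the [e_l] into an
    identity between series of graphs, to which the same counting lemmas
    apply. *)
Lemma chromatic_cliques l (m : monomial) :
  chromatic_symmetric (@clique_adj l) m = (prod_fact l)%:R * elementary_part l m.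
Proof.
rewrite /prod_fact; elim: l m => [|i l IHl] m; rewrite /elementary_part !(big_nil, big_cons).
  rewrite mul1r /ps_one.
  have one (k : {ffun void -> nat}) : coloring_monomial k = mset0.
    rewrite /coloring_monomial (_ : enum {: void} = [::]).
      by apply/msetP => j; rewrite mset_seqE mset0E.
    by apply: size0nil; rewrite -cardE card_void.
  pose k0 : {ffun void -> nat} := [ffun => 0%N].
  have kE (k : {ffun void -> nat}) : k = k0 by apply/ffunP => -[].
  rewrite /chromatic_symmetric (@ps_sum_seq _ _ _ _ [seq k0 | _ <- nseq (m == mset0) tt]).
  - by rewrite size_map size_nseq.
  - by case: (m == mset0).
  move=> k; rewrite (kE k); split; rewrite /= one.
    by case: eqP => // -> _; split=> // -[].
  by case=> _ <-; rewrite eqxx mem_head.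
rewrite natrM chromatic_sum_adj !ps_mul_finite big_distrr; apply: eq_bigr => p _.
by rewrite chromatic_complete IHl /elementary_part /= mulrACA.
Qed.

(** * Linear functionals applied to an e-positive graph *)

Definition monomials N n : seq monomial :=
  undup [seq seq_mset [seq val j | j <- tval t] | t <- enum {: n.-tuple 'I_N}].

Lemma monomials_bounded N n m : m \in monomials N n -> bounded_colors N m.
Proof.
rewrite mem_undup => /mapP[t _ ->] i.
by rewrite (perm_mem (perm_eq_seq_mset _)) => /mapP[j _ ->]; apply: ltn_ord.
Qed.

Lemma colors_in_monomials (V : finType) N n (k : {ffun V -> 'I_N}) :
  (seq_mset (colors k) \in monomials N n) = (#|V| == n).
Proof.
rewrite mem_undup; apply/mapP/eqP => [[t _ /eq_seq_msetP/perm_size]|].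
  by rewrite !size_map -enumT -cardE size_tuple.
move=> nE; have sz : size [seq k v | v <- enum V] == n by rewrite size_map -cardE nE.
by exists (Tuple sz); rewrite ?mem_enum // -map_comp.
Qed.

(** A weight on monomials is a linear functional on series; on a chromatic series
    it becomes a weighted count of colourings. *)
Lemma sum_chromatic (V : finType) (e : rel V) N n (w : monomial -> rat) :
  \sum_(m <- monomials N n) w m * chromatic_symmetric e m =
    if #|V| == n then
      \sum_(k : {ffun V -> 'I_N} | properb e k) w (seq_mset (colors k)) else 0.
Proof.
transitivity (\sum_(m <- monomials N n) \sum_(k : {ffun V -> 'I_N} | properb e k)
    w m * (seq_mset (colors k) == m)%:R).
  rewrite big_seq [RHS]big_seq; apply: eq_bigr => m /monomials_bounded mN.
  by rewrite (chromatic_coef _ mN) big_distrr.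
rewrite exchange_big /=.
transitivity (\sum_(k : {ffun V -> 'I_N} | properb e k)
    if #|V| == n then w (seq_mset (colors k)) else 0).
  apply: eq_bigr => k _; rewrite -(colors_in_monomials n k).
  have [km|km] := boolP (_ \in _).
    rewrite (bigD1_seq (seq_mset (colors k))) ?undup_uniq //= eqxx mulr1.
    by rewrite big1 ?addr0 // => m /negPf mk; rewrite eq_sym mk mulr0.
  rewrite big1_seq // => m /= mm; case: eqP => [mE|]; rewrite ?mulr0 //.
  by rewrite mE mm in km.
by case: eqP => // _; rewrite big1.
Qed.

(** The form in which e-positivity is used: the weight [w] and the number [N] of
    colours are arbitrary. Comparing only monomials of degree [#|V|] removes the
    [l] of another weight, and the factorials are absorbed in [c]. *)
Lemma e_positive_coloring_sums (V : finType) (e : rel V) : e_positive e ->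
  exists (S : seq (seq nat)) (c : seq nat -> rat),
    (forall l, l \in S -> [/\ is_partition l, sumn l = #|V| & 0 <= c l]) /\
    forall N (w : monomial -> rat),
      \sum_(k : {ffun V -> 'I_N} | properb e k) w (seq_mset (colors k)) =
      \sum_(l <- S) c l *
        \sum_(k : {ffun clique_vertices l -> 'I_N} | properb (@clique_adj l) k)
           w (seq_mset (colors k)).
Proof.
case=> S [c [cS eE]].
exists [seq l <- S | sumn l == #|V|]; exists (fun l => c l / (prod_fact l)%:R).
split=> [l|N w].
  rewrite mem_filter => /andP[/eqP lV /cS[lp c_ge0]].
  by split=> //; rewrite divr_ge0 ?ler0n.
have := sum_chromatic e N #|V| w; rewrite eqxx => <-.
under eq_bigr => m _ do rewrite eE big_distrr.
rewrite exchange_big big_filter [RHS]big_mkcond; apply: eq_bigr => l _.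
have fl_neq0 : (prod_fact l)%:R != 0 :> rat.
  by rewrite pnatr_eq0 -lt0n /prod_fact; apply: prodn_gt0 => i; apply: fact_gt0.
transitivity (c l / (prod_fact l)%:R *
    \sum_(m <- monomials N #|V|) w m * chromatic_symmetric (@clique_adj l) m).
  rewrite big_distrr; apply: eq_bigr => m _ /=.
  by rewrite chromatic_cliques; field.
by rewrite sum_chromatic card_clique_vertices; case: eqP => // _; rewrite mulr0.
Qed.

Lemma sum1_natr (T : finType) (P : pred T) : \sum_(k | P k) (1 : rat) = #|P|%:R.
Proof. by rewrite -sum1_card natr_sum. Qed.

(** * First functional: counting colourings *)

Definition ffact_poly i : {poly rat} := \prod_(j < i) ('X - j%:R%:P).

Lemma horner_ffact_poly i q : (ffact_poly i).[q%:R] = (q ^_ i)%:R.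
Proof.
elim: i => [|i IHi]; rewrite /ffact_poly ?big_ord0 ?hornerC // big_ord_recr hornerM.
rewrite -/(ffact_poly i) IHi hornerXsubC ffactnSr natrM.
have [iq|qi] := leqP i q; first by rewrite natrB.
by rewrite ffact_small // !mul0r.
Qed.

Definition clique_poly l := \prod_(i <- l) ffact_poly i.

Lemma card_proper_complete i q :
  \sum_(k : {ffun 'I_i -> 'I_q} | properb (@complete_adj 'I_i) k) (1 : rat)
    = (q ^_ i)%:R.
Proof.
rewrite sum1_natr -[in RHS](card_ord q) -[in RHS](card_ord i).
rewrite -card_inj_ffuns; congr (_%:R); apply: eq_card => k; rewrite inE.
apply/properP/injectiveP => [kp u v kuv|k_inj u v]; last exact/contra_neq/k_inj.
by apply/eqP; apply: contraT => /kp; rewrite kuv eqxx.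
Qed.

Lemma card_proper_cliques l q :
  \sum_(k : {ffun clique_vertices l -> 'I_q} | properb (@clique_adj l) k) (1 : rat)
    = (clique_poly l).[q%:R].
Proof.
rewrite /clique_poly; elim: l => [|i l IHl]; rewrite !(big_nil, big_cons).
  pose k0 : {ffun void -> 'I_q} := [ffun v : void => match v with end].
  rewrite hornerC sum1_natr (@fintype.eq_card1 _ k0 (properb (@clique_adj [::]))) // => k.
  rewrite !inE; apply/properP/eqP => [_|_ []]; apply/ffunP => -[].
rewrite hornerM -IHl horner_ffact_poly -card_proper_complete.
by rewrite (big_sum_adj _ (@clique_adj l)) big_distrl; apply: eq_bigr => k _; rewrite /= mul1r.
Qed.

(** Each positive part contributes a factor ['X], so two parts kill the linear
    coefficient. *)
Lemma clique_poly_coef1 l :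
  all (fun i => 0 < i)%N l -> (1 < size l)%N -> (clique_poly l)`_1 = 0.
Proof.
have factorX i : (0 < i)%N -> exists p, ffact_poly i = 'X * p.
  case: i => // i _; exists (\prod_(j < i) ('X - j.+1%:R%:P)).
  by rewrite /ffact_poly big_ord_recl /= subr0.
case: l => [|i [|j l]] //= /and3P[/factorX[p pE] /factorX[p' p'E] _] _.
by rewrite /clique_poly !big_cons pE p'E -mulrA coefXM /= mulrCA -mulrA coefXM.
Qed.

Lemma poly0_nat (p : {poly rat}) : (forall q : nat, p.[q%:R] = 0) -> p = 0.
Proof.
move=> p0; apply/eqP; apply: contraT => /max_poly_roots.
move/(_ [seq i%:R | i <- iota 0 (size p)]); rewrite size_map size_iota ltnn; apply.
  by rewrite all_map; apply/allP => i _; apply/rootP/p0.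
by rewrite map_inj_uniq ?iota_uniq // => i j /eqP; rewrite eqr_nat => /eqP.
Qed.

(** A polynomial is determined by its values at the natural numbers, hence [p] is
    the polynomial obtained by deletion-contraction. *)
Lemma connected_linear_coef (V : finType) (e : rel V) (p : {poly rat}) :
    irreflexive e -> graph_connected e -> (0 < #|V|)%N ->
    (forall q, \sum_(k : {ffun V -> 'I_q} | properb e k) 1 = p.[q%:R]) ->
  p`_1 != 0.
Proof.
move=> e_irr e_con V_gt0 pE.
pose s := [seq x <- enum {: V * V} | e x.1 x.2].
have sE x y : ((x, y) \in s) = e x y by rewrite mem_filter mem_enum andbT.
have [p' [p'E _ p'_gt0]] := chromatic_polynomial s V_gt0.
have -> : p = p'.
  apply/eqP; rewrite -subr_eq0; apply/eqP/poly0_nat => q.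
  rewrite hornerD hornerN -pE p'E; apply/eqP; rewrite subr_eq0 sum1_natr.
  apply/eqP; congr (_%:R); apply: eq_card => k; rewrite inE.
  apply/properP/allP => [kp [x y]|ks x y].
    by rewrite sE; apply: kp.
  by rewrite -sE => /ks.
apply: contraTneq (p'_gt0 _ _) => [->|| x y]; first by rewrite mulr0 ltxx.
  by apply/allP => -[x y]; rewrite sE; apply: contraTneq => /= ->; rewrite e_irr.
apply: connect_sub (e_con x y) => u v uv; apply: connect1.
by rewrite /list_adj sE uv.
Qed.

(** * Second functional: signed colourings *)

(** The block of the colour [i] is [i./2]. The comparison with [iota 0 n] says that
    each block is used as often as it has colours below [n]. *)
Definition block_weight n (m : monomial) : rat :=
  if perm_eq [seq i./2 | i <- enum_mset m] [seq i./2 | i <- iota 0 n]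
  then (-1) ^+ sumn (enum_mset m) else 0.

Section Flip.
Variable n : nat.

(** Exchanges the two colours of a block. The default value of [insubd] makes
    it fix the single colour of the last block when [n] is odd. *)
Definition flip (j : 'I_n) : 'I_n := insubd j (if odd j then j.-1 else j.+1).

Lemma val_flip j :
  val (flip j) = if odd j then j.-1 else if (j.+1 < n)%N then j.+1 else j.
Proof.
rewrite val_insubd; case: (odd j) => //.
by rewrite (leq_ltn_trans (leq_pred j)).
Qed.

Lemma half_flip j : (flip j)./2 = j./2.
Proof. by have := val_flip j => /= ->; case: ifP => jo; [|case: ifP => jn]; lia. Qed.

Lemma flipK : involutive flip.
Proof.
move=> j; apply: val_inj; rewrite val_flip; have := val_flip j => /= ->.
have jn := ltn_ord j; case jo: (odd j); last case: (ltnP j.+1 n) => jn1.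
- by rewrite ifF ?ifT; lia.
- by rewrite ifT; lia.
- by rewrite jo ltnNge jn1.
Qed.

Lemma odd_flip (j : 'I_n) : ((j./2).*2.+1 < n)%N -> odd (flip j) = ~~ odd j.
Proof. by have := val_flip j => /= -> jn; case: ifP => jo; [|case: ifP => jn1]; lia. Qed.

Lemma flip_neq (j : 'I_n) : odd j || (j.+1 < n)%N -> flip j != j.
Proof. by rewrite -val_eqE val_flip /=; case: ifP => jo; [|case: ifP => jn]; lia. Qed.

End Flip.

Section SignedColorings.
Variables (V : finType) (e : rel V) (n : nat).
Hypotheses (e_sym : symmetric e) (e_irr : irreflexive e) (card_V : #|V| = n).
Implicit Types (k : {ffun V -> 'I_n}) (u v : V).

Definition balanced k :=
  perm_eq [seq (k v)./2 | v <- enum V] [seq i./2 | i <- iota 0 n].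

(** When [#|V| = n], a perfect or almost perfect matching with labelled and
    oriented edges: the blocks number the edges, the colours orient them. *)
Definition matched k :=
  injectiveb k && [forall u, forall v, (u != v) && ((k u)./2 == (k v)./2) ==> e u v].

Lemma matchedP k :
  reflect (injective k /\ forall u v, u != v -> (k u)./2 = (k v)./2 -> e u v)
    (matched k).
Proof.
apply: (iffP andP) => -[/injectiveP k_inj H]; split=> //.
  move=> u v uv kuv; move/forallP: H => /(_ u)/forallP/(_ v)/implyP; apply.
  by rewrite uv kuv eqxx.
by apply/forallP => u; apply/forallP => v; apply/implyP => /andP[uv /eqP]; apply: H.
Qed.

Definition coloring_sign k : rat := (-1) ^+ sumn (colors k).

Lemma block_weight_colors k :
  block_weight n (seq_mset (colors k)) = if balanced k then coloring_sign k else 0.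
Proof.
have kp := perm_eq_seq_mset (colors k).
rewrite /block_weight (perm_sumn kp) /balanced.
rewrite (permPl (perm_map half kp)) /colors -map_comp.
by [].
Qed.

(** In a balanced colouring at most two vertices share a block, and only one if
    the block is the incomplete one. *)
Lemma block_size k (s : seq V) h : balanced k -> uniq s ->
  {in s, forall v, (k v)./2 = h} -> (size s <= ((h.*2.+1 < n)%N).+1)%N.
Proof.
move=> kb s_uniq sh.
apply: (@leq_trans (size [seq i <- iota 0 n | i./2 == h])).
  have /permP/(_ (pred1 h)) := kb; rewrite !count_map size_filter => <-.
  rewrite -size_filter; apply: uniq_leq_size => // v vs.
  by rewrite mem_filter -enumT mem_enum /= sh // eqxx.
pose t := if (h.*2.+1 < n)%N then [:: h.*2; h.*2.+1] else [:: h.*2].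
have -> : ((h.*2.+1 < n)%N).+1 = size t by rewrite /t; case: ifP.
apply: uniq_leq_size; first by rewrite filter_uniq // iota_uniq.
move=> i; rewrite mem_filter mem_iota /t; case: ifP; rewrite !inE; lia.
Qed.

(** In a balanced colouring such a vertex can change its colour within its block:
    the only other vertex of the block is not a neighbour. *)
Definition lonely k v := [exists u, [&& u != v, (k u)./2 == (k v)./2 & ~~ e v u]].

Definition recolor k v := [ffun x => if x == v then flip (k x) else k x].

(** The vertex to flip is chosen from the predicate [lonely k], which depends only
    on the blocks; these do not change, so the same vertex is chosen again and
    [switch] is an involution. *)
Definition switch k := if [pick v | lonely k v] is Some v then recolor k v else k.

Lemma half_recolor k v x : (recolor k v x)./2 = (k x)./2.
Proof. by rewrite ffunE; case: eqP => // _; rewrite half_flip. Qed.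

Lemma lonely_recolor k v : lonely (recolor k v) =1 lonely k.
Proof. by move=> x; apply: eq_existsb => u; rewrite !half_recolor. Qed.

Lemma lonely_switch k : lonely (switch k) =1 lonely k.
Proof. by rewrite /switch; case: pickP => // v _; apply: lonely_recolor. Qed.

Lemma switchK : involutive switch.
Proof.
move=> k; rewrite {1}/switch (eq_pick (lonely_switch k)) /switch.
case: pickP => // v _; apply/ffunP => x; rewrite !ffunE.
by case: eqP => // _; rewrite flipK.
Qed.

Lemma balanced_switch k : balanced (switch k) = balanced k.
Proof.
rewrite /switch; case: pickP => // v _; rewrite /balanced.
by congr (perm_eq _ _); apply: eq_map => x; rewrite half_recolor.
Qed.

(** A conflict could only come from a neighbour in the block of the flipped vertex
    [v]; with [v] and its nonadjacent companion this would be a third vertex in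
    one block. *)
Lemma proper_switch k : balanced k -> properb e k -> properb e (switch k).
Proof.
move=> kb /properP kp; rewrite /switch; case: pickP => [v|_]; last exact/properP.
case/existsP=> u /and3P[uv /eqP kuv nvu].
have main y : e v y -> flip (k v) != k y.
  move=> vy; apply: contraTneq (vy) => kvy; apply/negP => _.
  have kyv : (k y)./2 = (k v)./2 by rewrite -kvy half_flip.
  have yv : y != v by apply: contraTneq vy => ->; rewrite e_irr.
  have yu : y != u by apply: contraNneq nvu => <-.
  have := @block_size k [:: y; u; v] (k v)./2 kb; rewrite /= !inE negb_or yv yu uv.
  move=> /(_ isT) three; suff : (3 <= ((((k v)./2).*2.+1 < n)%N).+1)%N.
    by case: (_ < n)%N.
  by apply: three => x; rewrite !inE => /or3P[] /eqP ->.
apply/properP => x y xy; rewrite !ffunE.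
case: (eqVneq x v) (eqVneq y v) xy => [->|_] [->|_] xy; last exact: kp.
- by rewrite e_irr in xy.
- exact: main.
- by rewrite eq_sym main // e_sym.
Qed.

Lemma coloring_signE k : coloring_sign k = \prod_v (-1) ^+ k v.
Proof. by rewrite /coloring_sign sumnE big_map big_enum -prodrXr. Qed.

(** The flipped vertex shares its block with another one, so the block has two
    colours, of opposite parities. *)
Lemma sign_switch k : balanced k -> [exists v, lonely k v] ->
  coloring_sign (switch k) = - coloring_sign k.
Proof.
move=> kb /existsP[v0 v0P]; rewrite /switch; case: pickP => [v|/(_ v0)]; last by rewrite v0P.
case/existsP=> u /and3P[uv /eqP kuv _].
have moved : (((k v)./2).*2.+1 < n)%N.
  have := @block_size k [:: u; v] (k v)./2 kb; rewrite /= !inE uv => /(_ isT).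
  case: (_ < n)%N => //; apply=> x; by rewrite !inE => /orP[] /eqP ->.
rewrite !coloring_signE (bigD1 v) //= [in RHS](bigD1 v) //= -mulNr; congr (_ * _).
  by rewrite ffunE eqxx -signr_odd odd_flip // -[in RHS]signr_odd; case: odd; rewrite ?opprK.
by apply: eq_bigr => x /negPf xv; rewrite ffunE xv.
Qed.

Lemma perm_colors k : injective k -> perm_eq (colors k) (iota 0 n).
Proof.
move=> k_inj; have k_uniq : uniq (colors k).
  by rewrite map_inj_uniq ?enum_uniq // => u v /val_inj/k_inj.
have k_lt : {subset colors k <= iota 0 n}.
  by move=> i /mapP[v _ ->]; rewrite mem_iota ltn_ord.
have k_size : (size (iota 0 n) <= size (colors k))%N.
  by rewrite size_iota size_map -cardE card_V.
apply: uniq_perm (iota_uniq 0 n) _ => //; exact: (uniq_min_size k_uniq k_lt k_size).2.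
Qed.

(** Colourings with a lonely vertex cancel in pairs under [switch]. In the others,
    vertices of a common block are adjacent, hence have distinct colours: these
    colourings are bijective, which determines their sign. *)
Lemma sum_block_weight :
  \sum_(k : {ffun V -> 'I_n} | properb e k) block_weight n (seq_mset (colors k)) =
    (-1) ^+ sumn (iota 0 n) * #|matched|%:R.
Proof.
transitivity (\sum_(k : {ffun V -> 'I_n} | properb e k && balanced k) coloring_sign k).
  by rewrite big_mkcondr; apply: eq_bigr => k _; apply: block_weight_colors.
rewrite (bigID (fun k => [exists v, lonely k v])) /=.
set s := \sum_(k | _ && [exists v, _]) _.
have s0 : s = 0.
  suff : s = - s by lra.
  rewrite {1}/s (reindex_inj (inv_inj switchK)) -sumrN.
  have lsw k : [exists v, lonely (switch k) v] = [exists v, lonely k v].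
    exact/eq_existsb/lonely_switch.
  apply: eq_big => [k|k /andP[/andP[_]]]; rewrite balanced_switch lsw; last exact: sign_switch.
  congr (_ && _); apply: andb_id2r => kb; apply/idP/idP; last exact: proper_switch.
  by move/(proper_switch); rewrite balanced_switch switchK; apply.
(* No lonely vertex: the sign is that of the identity permutation of the colours. *)
rewrite s0 add0r mulr_natr -sumr_const; apply: eq_big => [k|k].
  apply/andP/matchedP => [[/andP[/properP kp kb] /existsPn nl]|[k_inj ke]].
    have ke u v : u != v -> (k u)./2 = (k v)./2 -> e u v.
      move=> uv kuv; apply: contraR (nl u) => nuv; apply/existsP; exists v.
      by rewrite eq_sym uv kuv eqxx.
    split=> // u v kuv; apply/eqP; apply: contraT => uv.
    by have := kp _ _ (ke _ _ uv (congr1 (fun j : 'I_n => j./2) kuv)); rewrite kuv eqxx.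
  split; first (apply/andP; split).
  - by apply/properP => u v uv; apply: contraTneq uv => /k_inj ->; rewrite e_irr.
  - by have := perm_map half (perm_colors k_inj); rewrite /colors -map_comp.
  - apply/existsPn => u; apply/existsPn => v; apply/negP => /and3P[vu /eqP kvu /negP[]].
    by apply: ke; rewrite // eq_sym.
case/andP=> /andP[/properP kp kb] /existsPn nl.
rewrite /coloring_sign (perm_sumn (perm_colors _)) // => u v kuv.
apply/eqP; apply: contraT => uv; have := nl v; rewrite negb_exists => /forallP/(_ u).
by rewrite uv kuv eqxx negbK => /kp; rewrite kuv eqxx.
Qed.

End SignedColorings.

(** * Matchings from colourings *)

Lemma perfect_matching_of_involution (T : finType) (r : rel T) (mu : T -> T) :
  involutive mu -> (forall x, r x (mu x)) -> has_perfect_matching r.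
Proof.
move=> muK r_mu; exists [set [set x; mu x]%SET | x : T]%SET; split.
  by apply/fintype.subsetP => _ /imsetP[x _ ->]; apply/imsetP; exists (x, mu x); rewrite ?inE.
move=> v; rewrite -(cards1 [set v; mu v]%SET); apply: eq_card => f; rewrite !inE.
apply/andP/eqP => [[/imsetP[x _ ->]]|->].
  by rewrite !inE => /orP[] /eqP ->; rewrite ?muK // finset.setUC.
by split; [apply: imset_f | rewrite !inE eqxx].
Qed.

Section MatchingOfColoring.
Variables (V : finType) (e : rel V) (n : nat) (k : {ffun V -> 'I_n}).
Hypotheses (card_V : #|V| = n) (k_matched : matched e k).

(** Colours are permuted by [flip], and a matched colouring is a bijection: this
    transports [flip] to the vertices. *)
Lemma flip_partner :
  exists2 mu : V -> V, involutive mu & forall v, k (mu v) = flip (k v).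
Proof.
have [k_inj _] := matchedP e k k_matched.
have [g kK gK] : bijective k by apply: inj_card_bij; rewrite ?card_ord ?card_V.
exists (fun v => g (flip (k v))) => [v|v]; last by rewrite gK.
by rewrite gK flipK kK.
Qed.

Lemma flip_partner_adj (mu : V -> V) v : k (mu v) = flip (k v) ->
  flip (k v) != k v -> e v (mu v).
Proof.
have [_ ke] := matchedP e k k_matched; move=> kmu kv; apply: ke.
  by apply: contraNneq kv => {2}->; rewrite kmu.
by rewrite kmu half_flip.
Qed.

Lemma matched_perfect : ~~ odd n -> has_perfect_matching e.
Proof.
move=> n_even; have [mu muK kmu] := flip_partner.
apply: perfect_matching_of_involution muK _ => v; apply: flip_partner_adj => //.
by apply: flip_neq; have := ltn_ord (k v); lia.
Qed.

(** The vertex to delete is the one with colour [n.-1], the only colour fixed by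
    [flip]. *)
Lemma matched_almost_perfect : odd n -> has_almost_perfect_matching e.
Proof.
move=> n_odd; have [mu muK kmu] := flip_partner.
have [k_inj _] := matchedP e k k_matched.
have n_gt0 : (n.-1 < n)%N by case: n n_odd.
have [g kK gK] : bijective k by apply: inj_card_bij; rewrite ?card_ord ?card_V.
pose v0 := g (Ordinal n_gt0).
(* For odd [n] the last colour is even and its block has no other colour. *)
have mu_v0 : mu v0 = v0.
  apply: k_inj; rewrite kmu; apply: val_inj; rewrite val_flip /v0 gK /=.
  by case: n n_odd => //= n' n'_even; rewrite (negPf n'_even) ltnn.
have mu_neq (x : {x : V | x != v0}) : mu (val x) != v0.
  by apply: contraNneq (valP x) => xv0; rewrite -(muK (val x)) xv0 mu_v0.
exists v0; apply: (@perfect_matching_of_involution _ _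
    (fun x => exist (fun x => x != v0) (mu (val x)) (mu_neq x))) => x.
  by apply: val_inj; rewrite /= muK.
rewrite /del_vertex /=; apply: flip_partner_adj => //; apply: flip_neq.
have : k (val x) != Ordinal n_gt0.
  by apply: contraNneq (valP x) => kx; rewrite -(kK (val x)) kx.
rewrite -val_eqE /=; have := ltn_ord (k (sval x)); lia.
Qed.

End MatchingOfColoring.

(** * Comparison of the two functionals *)

Lemma clique_adj_sym l : symmetric (@clique_adj l).
Proof.
elim: l => [|i l IHl]; first by case.
by move=> [x|x] [y|y] //=; rewrite /complete_adj eq_sym.
Qed.

Lemma clique_adj_irr l : irreflexive (@clique_adj l).
Proof.
elim: l => [|i l IHl]; first by case.
by move=> [x|x] /=; [rewrite /complete_adj eqxx | apply: IHl].
Qed.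

Lemma single_clique_matched n :
  exists k : {ffun clique_vertices [:: n] -> 'I_n}, matched (@clique_adj [:: n]) k.
Proof.
exists [ffun x : 'I_n + void => match x with inl i => i | inr v => match v with end end].
apply/matchedP; split=> [[i|[]] [j|[]]|[i|[]] [j|[]]] //=; rewrite !ffunE //.
by move=> ->.
Qed.

(** If there were no matched colouring, the second functional would vanish on [e],
    hence on each term of the expansion as all of them have the same sign; the
    coefficient of the single clique would be zero, and the chromatic polynomial
    of [e] would have no linear term. *)
Lemma positive_connected_matching n (V : finType) (e : rel V) :
    symmetric e -> irreflexive e -> #|V| = n -> (0 < n)%N ->
    graph_connected e -> e_positive e ->
  exists k : {ffun V -> 'I_n}, matched e k.
Proof.
move=> e_sym e_irr card_V n_gt0 e_con /e_positive_coloring_sums[S [c [cS eE]]].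
have [k km|no_k] := pickP (matched e (n := n)); first by exists k.
have cm0 : \sum_(l <- S) c l * #|matched (@clique_adj l) (n := n)|%:R = 0.
  apply: (@mulfI _ ((-1) ^+ sumn (iota 0 n))); first by rewrite signr_eq0.
  have := eE n (block_weight n); rewrite sum_block_weight // (eq_card0 no_k).
  rewrite !mulr0 => sum0; rewrite [RHS]sum0 [LHS]big_distrr big_seq [RHS]big_seq.
  apply: eq_bigr => l lS; have [_ lV _] := cS l lS; rewrite /= sum_block_weight.
  - by rewrite mulrCA.
  - exact: clique_adj_sym.
  - exact: clique_adj_irr.
  - by rewrite card_clique_vertices lV.
have c0 l : l \in S -> l = [:: n] -> c l = 0.
  move=> lS lE; have [k km] := single_clique_matched n.
  have terms_ge0 l' : l' \in S -> 0 <= c l' * #|matched (@clique_adj l') (n := n)|%:R.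
    by case/cS=> _ _ c_ge0; rewrite mulr_ge0 ?ler0n.
  move/eqP: cm0; rewrite big_seq psumr_eq0 // => /allP/(_ l lS)/implyP/(_ lS).
  rewrite mulf_eq0 pnatr_eq0 lE => /orP[/eqP //|/eqP/card0_eq/(_ k)].
  by rewrite -topredE /= km.
pose p := \sum_(l <- S) c l *: clique_poly l.
have /negP[] : p`_1 != 0.
  apply: (connected_linear_coef e_irr e_con); rewrite ?card_V // => q.
  rewrite (eE q (fun _ => 1)) /p horner_sum; apply: eq_bigr => l _.
  by rewrite card_proper_cliques hornerZ.
rewrite /p coef_sum big_seq big1 // => l lS; rewrite coefZ.
have [/andP[_ l_pos] lV _] := cS l lS.
case: (ltnP 1 (size l)) => [l2|l1]; first by rewrite clique_poly_coef1 ?mulr0.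
rewrite c0 ?mul0r //; move: lV l1 n_gt0; rewrite card_V.
by case: (l) => [|i [|j l']] //= <-; rewrite ?addn0.
Qed.

Theorem theorem7 (n : nat) (V : finType) (e : rel V)
    (e_sym : symmetric e) (e_irr : irreflexive e) (card_V : #|V| = n)
    (no_matching : ~~ odd n /\ ~ has_perfect_matching e
                   \/ odd n /\ ~ has_almost_perfect_matching e) :
  (graph_connected e -> ~ e_positive e) /\ (is_tree e -> ~ e_positive e).
Proof.
have main : graph_connected e -> ~ e_positive e.
  move=> e_con e_pos.
  have [n0|n_gt0] := posnP n.
    case: no_matching => -[n_par]; last by rewrite n0 in n_par.
    apply; apply: (@perfect_matching_of_involution _ _ id) => // x.
    by have := card0_eq (etrans card_V n0) x.
  have [k km] := positive_connected_matching e_sym e_irr card_V n_gt0 e_con e_pos.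
  case: no_matching => -[n_par]; apply.
    exact: matched_perfect card_V km n_par.
  exact: matched_almost_perfect card_V km n_par.
by split=> // -[/main].
Qed.
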